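(* There exists a sequence of polynomials $\mathcal P_n$, $n=1,2,\dots$, with $\mathcal P_n$ of degree $n$, $\mathcal P_1=x$ and $\mathcal P_2=x^2-2x+2$, such that for every $n\ge1$ $$\mathcal P_{n+1}''\mathcal P_n-2\mathcal P_{n+1}'\mathcal P_n'+\mathcal P_{n+1}\mathcal P_n''+n\,\mathcal P_{n+1}'\mathcal P_n-(n+1)\mathcal P_{n+1}\mathcal P_n'=0 .$$ Moreover, up to the constant factor $c_n=\big[(n-1)!\prod_{1\le i<j\le n-1}(j-i)\big]^{-1}$, these polynomials can be written as $$\mathcal P_n=c_n\exp\Big(-\frac{n(n-1)x}{2}\Big)W(\omega_1,\dots,\omega_n),$$ where $W$ denotes the Wronskian, $\omega_j=(x-a_j)\exp((j-1)x)$, and $a_1=0$, $a_{j+1}=a_j+\frac2j$. *)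

(* Defs.v *)
From HB Require Import structures.
From mathcomp Require Import all_boot all_order all_algebra.
From mathcomp Require Import all_classical all_reals all_analysis.
Set Implicit Arguments. Unset Strict Implicit. Unset Printing Implicit Defensive.
Import Order.TTheory GRing.Theory Num.Theory.
Local Open Scope ring_scope.

Definition wronskian (R : realType) (n : nat) (f : 'I_n -> R -> R) (x : R) : R :=
  \det (\matrix_(i < n, j < n) (derive1n i (f j)) x).

(* aseq k = a_{k+1}:  a_1 = 0,  a_{j+1} = a_j + 2/j. *)
Fixpoint aseq (R : realType) (k : nat) : R :=
  match k with
  | 0 => 0
  | k'.+1 => aseq R k' + 2 / (k'.+1)%:R
  end.

(* omega j = omega_{j+1} (0-indexed): (x - a_{j+1}) exp(j x). *)
Definition omega (R : realType) (j : nat) (x : R) : R :=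
  (x - aseq R j) * expR (j%:R * x).

Definition cn (R : realType) (n : nat) : R :=
  ((n.-1)`!%:R * \prod_(1 <= i < n) \prod_(i.+1 <= j < n) ((j - i)%N)%:R)^-1.

(* Main.v *)
(* Write omega_j = p_j exp(j x) with p_j = x - aseq j, so that differentiation
   acts on p_j as the twisted derivation [twist j], and let tau_n be the
   Wronskian of omega_0, ..., omega_{n-1} without its exponential factor. The
   recursion for aseq says exactly that omega_{j+1}'' = (j+1)^2 exp(x) omega_j,
   while omega_0'' = 0; hence W(1, omega_0, ..., omega_n) is a multiple of
   exp(n x) W(omega_0, ..., omega_{n-1}). Feeding this into the Desnanot-Jacobi
   identity gives, after normalisation,
     P_{m+2}' P_m - P_{m+2} P_m' + (m+1) P_{m+2} P_m = (m+1) P_{m+1}^2.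
   This relation determines the degrees by induction, and it propagates the
   bilinear equation from (P_m, P_{m+1}) to (P_{m+1}, P_{m+2}). *)
Require Import Defs.
From HB Require Import structures.
From mathcomp Require Import all_boot all_order all_algebra perm.
From mathcomp Require Import all_classical all_reals all_analysis.
From mathcomp Require Import ring zify.
Set Implicit Arguments. Unset Strict Implicit. Unset Printing Implicit Defensive.
Import Order.TTheory GRing.Theory Num.Theory.
Local Open Scope ring_scope.

(** * Schur complements and the Desnanot-Jacobi identity *)

(** Schur complement without division: [A] need not be invertible, so its inverse is replaced by
    [\adj A]. Multiplying [M] on the right by the block upper triangular [E] gives a block lower
    triangular matrix; then compare determinants and cancel a power of [\det A]. *)
Lemma det_schur (S : idomainType) (n k : nat) (M : 'M[S]_(n + k)) :
  let A := ulsubmx M in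
  \det A != 0 ->
  \det M * \det A ^+ k =
  \det A * \det (\det A *: drsubmx M - dlsubmx M *m \adj A *m ursubmx M).
Proof.
move=> A A0.
pose E : 'M[S]_(n + k) :=
  block_mx (\adj A) (- (\adj A *m ursubmx M)) 0 (\det A)%:M.
have ME : M *m E = block_mx (\det A)%:M 0 (dlsubmx M *m \adj A)
    (\det A *: drsubmx M - dlsubmx M *m \adj A *m ursubmx M).
  rewrite -{1}(submxK M) mulmx_block !mulmx0 !addr0 mul_mx_adj !mulmxN mulmxA.
  rewrite mul_mx_adj mul_scalar_mx !mul_mx_scalar addNr mulmxA.
  by congr block_mx; rewrite addrC.
have := congr1 determinant ME.
rewrite det_mulmx det_ublock det_lblock !det_scalar => detE.
have detadj : \det A * \det (\adj A) = \det A ^+ n.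
  by rewrite -det_mulmx mul_mx_adj det_scalar.
apply: (mulfI (expf_neq0 n A0)).
by rewrite [RHS]mulrCA -detE -{1}detadj; ring.
Qed.

(* Entries indexed by [nat], so that sizes can be rewritten without casts. *)
Definition nat_det (S : comNzRingType) (n : nat) (F : nat -> nat -> S) : S :=
  \det (\matrix_(i < n, j < n) F i j).

Lemma eq_nat_det (S : comNzRingType) (n : nat) (F G : nat -> nat -> S) :
  (forall i j, (i < n)%N -> (j < n)%N -> F i j = G i j) ->
  nat_det n F = nat_det n G.
Proof.
by move=> FG; congr (\det _); apply/matrixP=> i j; rewrite !mxE FG ?ltn_ord.
Qed.

(** On a determinant of size [n.+1], this replaces the last row or column by the one numbered
    [r]. *)
Definition set_at (n r i : nat) : nat := if i == n then r else i.

Lemma det_mx2 (S : comNzRingType) (M : 'M[S]_2) :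
  \det M = M 0 0 * M 1 1 - M 0 1 * M 1 0.
Proof.
rewrite (expand_det_row _ 0) !big_ord_recl big_ord0 addr0 /cofactor !det_mx11.
rewrite !mxE /= expr0 expr1 mul1r mulN1r mulrN.
by congr (M _ _ * M _ _ - M _ _ * M _ _); apply: val_inj.
Qed.

(** The four minors border the leading block of size [n] by one row and one column. By [det_schur]
    with [k = 1] they are the entries [N r s] of the scaled Schur complement, whose 2 by 2
    determinant is given by [det_schur] with [k = 2]. *)
Lemma desnanot_jacobi (S : idomainType) (n : nat) (F : nat -> nat -> S) :
  nat_det n F != 0 ->
  let minor r s := nat_det n.+1 (fun i j => F (set_at n r i) (set_at n s j)) in
  nat_det n F * nat_det n.+2 F =
  minor n n * minor n.+1 n.+1 - minor n n.+1 * minor n.+1 n.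
Proof.
move=> A0 minor.
pose A : 'M[S]_n := \matrix_(i, j) F i j.
pose N r s := nat_det n F * F r s
  - \sum_(j < n) (\sum_(i < n) F r i * \adj A i j) * F j s.
have minorE r s : minor r s = N r s.
  rewrite /minor -addn1 /nat_det; set M := \matrix_(_, _) _.
  have MA : ulsubmx M = A.
    apply/matrixP=> i j; rewrite !mxE /set_at /=.
    by rewrite (ltn_eqF (ltn_ord i)) (ltn_eqF (ltn_ord j)).
  have := @det_schur S n 1 M; rewrite MA => /(_ A0); rewrite expr1 mulrC.
  move=> /(mulfI A0) ->; rewrite det_mx11 !mxE /N /= /set_at !addn0 eqxx.
  congr (_ - _); apply: eq_bigr => j _; rewrite !mxE /= /set_at addn0 eqxx.
  rewrite (ltn_eqF (ltn_ord j)); congr (_ * _); apply: eq_bigr => i _.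
  by rewrite !mxE /= /set_at addn0 eqxx (ltn_eqF (ltn_ord i)).
rewrite -addn2 [nat_det (n + 2) F]/nat_det; set M := \matrix_(_, _) _.
have MA : ulsubmx M = A by apply/matrixP=> i j; rewrite !mxE.
have := @det_schur S n 2 M; rewrite MA => /(_ A0).
rewrite expr2 mulrCA => /(mulfI A0); rewrite mulrC => ->.
have entry (a b : 'I_2) :
    (\det A *: drsubmx M - dlsubmx M *m \adj A *m ursubmx M) a b
    = minor (n + a)%N (n + b)%N.
  rewrite minorE /N !mxE; congr (_ - _); apply: eq_bigr => j _.
  by rewrite !mxE; congr (_ * _); apply: eq_bigr => i _; rewrite !mxE.
by rewrite det_mx2 !entry /= !addn0 !addn1.
Qed.

(** * Twisted derivations and Wronskians stripped of exponentials *)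

Definition twist (R : comNzRingType) (l : R) (p : {poly R}) : {poly R} :=
  p^`() + l *: p.

Lemma twistM (R : comNzRingType) (a b : R) (p q : {poly R}) :
  twist (a + b) (p * q) = twist a p * q + p * twist b q.
Proof. by rewrite /twist derivM -!mul_polyC polyCD; ring. Qed.

Lemma twist_sum (R : comNzRingType) (l : R) (I : finType) (F : I -> {poly R}) :
  twist l (\sum_i F i) = \sum_i twist l (F i).
Proof. by rewrite /twist raddf_sum scaler_sumr -big_split. Qed.

Lemma twist_prod (R : comNzRingType) (n : nat) (l : 'I_n -> R)
    (F : 'I_n -> {poly R}) :
  twist (\sum_i l i) (\prod_i F i) =
  \sum_i \prod_k (if k == i then twist (l k) (F k) else F k).
Proof.
elim: n l F => [|n IHn] l F.
  by rewrite !big_ord0 /twist derivC scale0r addr0.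
rewrite !big_ord_recl twistM IHn eqxx mulr_sumr; congr (_ * _ + _).
by apply: eq_bigr => k _; rewrite [RHS]big_ord_recl.
Qed.

Lemma twist_det (R : comNzRingType) (n : nat) (l : 'I_n -> R)
    (M : 'M[{poly R}]_n) :
  twist (\sum_j l j) (\det M) =
  \sum_i \det (\matrix_(k, j) if k == i then twist (l j) (M k j) else M k j).
Proof.
rewrite /determinant twist_sum exchange_big; apply: eq_bigr => s _ /=.
(* Weights belong to columns: listing them along [s] gives the factor in row [k] the weight of its
   column [s k]. *)
rewrite -mulr_sumr (reindex_inj (@perm_inj _ s)) /=.
have -> (c : bool) (p : {poly R}) (a : R) :
    twist a ((-1) ^+ c * p) = (-1) ^+ c * twist a p.
  by case: c; rewrite ?expr0 ?mul1r // !mulN1r /twist derivN scalerN opprD.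
rewrite twist_prod; congr (_ * _); apply: eq_bigr => i _.
by apply: eq_bigr => k _; rewrite mxE.
Qed.

(** Entry of a Wronskian matrix: the [i]-th derivative of [f j] times exp([l j] x), with the
    exponential removed. *)
Definition jet (R : comNzRingType) (l : nat -> R) (f : nat -> {poly R})
  (i j : nat) : {poly R} := iter i (twist (l j)) (f j).

(** Differentiating any row but the last makes it equal to the next row, so only the last row
    contributes. *)
Lemma twist_nat_det_jet (R : comNzRingType) (n : nat) (l : nat -> R)
    (f : nat -> {poly R}) :
  twist (\sum_(j < n.+1) l j) (nat_det n.+1 (jet l f)) =
  nat_det n.+1 (fun i j => jet l f (set_at n n.+1 i) j).
Proof.
rewrite /nat_det twist_det (bigD1 ord_max) //= [X in _ + X]big1 ?addr0.
  congr (\det _); apply/matrixP=> i j; rewrite !mxE /set_at -val_eqE /=.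
  by case: eqP => // ->.
move=> i ni; have lin : (i < n)%N.
  by rewrite ltn_neqAle -ltnS ltn_ord andbT -val_eqE in ni *.
have lti : (i.+1 < n.+1)%N by [].
apply: (determinant_alternate (i1 := i) (i2 := Ordinal lti)).
  by rewrite -val_eqE /= ltn_eqF.
by move=> j; rewrite !mxE eqxx -val_eqE /= gtn_eqF.
Qed.

(* Multiplying all functions by exp(x) raises every weight by one; each row
   gains a combination of the earlier rows. *)
Lemma nat_det_jet_shift (R : comNzRingType) (n : nat) (l : nat -> R)
    (f : nat -> {poly R}) :
  nat_det n (jet (fun j => l j + 1) f) = nat_det n (jet l f).
Proof.
have shiftE i j : jet (fun j => l j + 1) f i j
    = \sum_(k < i.+1) jet l f k j *+ 'C(i, k).
  rewrite /jet; elim: i => [|i IHi]; first by rewrite big_ord1 mulr1n.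
  rewrite iterS IHi.
  have -> p : twist (l j + 1) p = twist (l j) p + p.
    by rewrite /twist scalerDl scale1r addrA.
  rewrite twist_sum [X in _ + X]big_ord_recl [RHS]big_ord_recl /= !bin0 addrCA.
  congr (_ + _).
  under [in RHS]eq_bigr => k _ do rewrite /bump /= add1n binS mulrnDr.
  rewrite [RHS]big_split /= addrC; congr (_ + _); last first.
    apply: eq_bigr => k _.
    by rewrite /twist derivMn -scalerMnr mulrnDl.
  rewrite big_ord_recr /= bin_small // mulr0n addr0.
  by apply: eq_bigr.
pose L : 'M[{poly R}]_n := \matrix_(i, k) ('C(i, k))%:R.
have L1 : \det L = 1.
  rewrite det_trig; first by rewrite big1 // => i _; rewrite mxE binn.
  by apply/is_trig_mxP => i k ik; rewrite mxE bin_small.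
rewrite /nat_det -[RHS]mul1r -L1 -det_mulmx; congr (\det _).
apply/matrixP=> i j; rewrite !mxE shiftE.
rewrite (big_ord_widen n (fun k => jet l f k j *+ 'C(i, k))) //.
rewrite big_mkcond; apply: eq_bigr => k _; rewrite !mxE mulr_natl.
by case: ltnP => // ?; rewrite bin_small.
Qed.

Lemma nat_det_scale_col (S : comNzRingType) (n : nat) (c : nat -> S)
    (F : nat -> nat -> S) :
  nat_det n (fun i j => F i j * c j) = nat_det n F * \prod_(j < n) c j.
Proof.
transitivity (\det ((\matrix_(i < n, j < n) F i j) *m
                    diag_mx (\row_(j < n) c j))).
  by congr (\det _); apply/matrixP=> i j; rewrite mul_mx_diag !mxE.
by rewrite det_mulmx det_diag; under eq_bigr do rewrite mxE.
Qed.

Lemma nat_det_unit_col (S : comNzRingType) (n k : nat) (F : nat -> nat -> S) :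
  (k <= n)%N -> (forall i, F i k = (i == 0)%:R) ->
  nat_det n.+1 F = (-1) ^+ k * nat_det n (fun i j => F i.+1 (bump k j)).
Proof.
move=> kn Fk; have kn1 : (k < n.+1)%N by [].
rewrite /nat_det (expand_det_col _ (Ordinal kn1)) big_ord_recl big1 ?addr0.
  rewrite mxE Fk mul1r /cofactor; congr (_ * \det _).
  by apply/matrixP=> i j; rewrite !mxE.
by move=> i _; rewrite mxE Fk mul0r.
Qed.

Lemma iter_twistZ (R : comNzRingType) (l c : R) (i : nat) (p : {poly R}) :
  iter i (twist l) (c *: p) = c *: iter i (twist l) p.
Proof.
elim: i => //= i ->; rewrite /twist derivZ scalerDr !scalerA.
by rewrite [l * c]mulrC.
Qed.

Lemma iter_twist0_1 (R : comNzRingType) (i : nat) :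
  iter i (twist (0 : R)) 1 = (i == 0%N)%:R.
Proof.
elim: i => //= i ->; rewrite /twist scale0r addr0.
by case: (i == 0%N); rewrite ?derivC // -polyC1 derivC.
Qed.

(** * The determinants [tau] and their three-term relation *)

Definition Xa (R : realType) (j : nat) : {poly R} := 'X - (aseq R j)%:P.

Definition tau (R : realType) (n : nat) : {poly R} :=
  nat_det n (jet (fun j => j%:R) (@Xa R)).

(** With k = j+1, two twists of x - a produce k^2 (x - a) + 2k; the increment 2/k of [aseq] absorbs
    exactly the term 2k. *)
Lemma twist2_Xa (R : realType) (j : nat) :
  twist j.+1%:R (twist j.+1%:R (Xa R j.+1)) = (j.+1%:R ^+ 2 : R) *: Xa R j.
Proof.
have j0 : j.+1%:R != 0 :> R by rewrite pnatr_eq0.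
rewrite /twist /Xa derivXsubC derivD derivZ derivXsubC -polyC1 derivC /=.
rewrite -!mul_polyC !polyCD polyC1 opprD.
have -> : j.+1%:R%:P *
      (1 + j.+1%:R%:P * ('X + (- (aseq R j)%:P - (2 / j.+1%:R)%:P)))
    = j.+1%:R%:P * (1 + j.+1%:R%:P * ('X - (aseq R j)%:P)
                    - (j.+1%:R * (2 / j.+1%:R))%:P) :> {poly R}.
  by rewrite [in RHS]polyCM; ring.
by rewrite mulrCA mulfV // mulr1 expr2 polyCM (polyCD 1 1) polyC1; ring.
Qed.

(* The family [omega_0, ..., omega_{n-1}, 1, omega_n, ...]: the constant [1]
   inserted in position [n], with zero exponential weight. *)
Definition ins_weight (R : realType) (n j : nat) : R :=
  if j == n then 0 else (unbump n j)%:R.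
Definition ins_poly (R : realType) (n j : nat) : {poly R} :=
  if j == n then 1 else Xa R (unbump n j).

(** Two expansions along unit columns: first the inserted [1], which gives the sign, then omega_0' =
    1. What remains are the second derivatives of omega_1, ..., omega_m. By [twist2_Xa] they yield
    the squared factorial and weights raised by one, which [nat_det_jet_shift] undoes. *)
Lemma nat_det_ins (R : realType) (n m : nat) : (n <= m.+1)%N ->
  nat_det m.+2 (jet (ins_weight R n) (ins_poly R n)) =
  (-1) ^+ n * (m`!%:R ^+ 2 * tau R m).
Proof.
move=> nm; rewrite (nat_det_unit_col nm); last first.
  by move=> i; rewrite /jet /ins_weight /ins_poly eqxx iter_twist0_1.
congr (_ * _); transitivity
    (nat_det m.+1 (fun i j => jet (fun j => j%:R) (@Xa R) i.+1 j)).
  apply: eq_nat_det => i j _ _.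
  by rewrite /jet /ins_weight /ins_poly eq_sym (negbTE (neq_bump _ _)) bumpK.
rewrite (@nat_det_unit_col _ m 0) //; last first.
  move=> i; rewrite /jet iterSr -iter_twist0_1; congr iter.
  by rewrite /twist /Xa /= subr0 derivX scale0r addr0.
rewrite expr0 mul1r /tau -nat_det_jet_shift mulrC.
have -> : m`!%:R ^+ 2 = \prod_(j < m) (j.+1%:R ^+ 2)%:P :> {poly R}.
  elim: m {nm} => [|m IHm]; first by rewrite big_ord0 expr1n.
  rewrite big_ord_recr -IHm /= factS natrM polyC_exp -polyC_natr; ring.
rewrite -(nat_det_scale_col _ (fun j => (j.+1%:R ^+ 2)%:P)).
apply: eq_nat_det => i j _ _.
rewrite /bump add1n /jet 2!iterSr twist2_Xa iter_twistZ -mul_polyC mulrC.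
by rewrite natr1.
Qed.

Lemma sum_ins_weight (R : realType) (n : nat) :
  \sum_(j < n.+1) ins_weight R n j = \sum_(j < n) j%:R.
Proof.
rewrite big_ord_recr /= /ins_weight eqxx addr0; apply: eq_bigr => j _.
by rewrite ltn_eqF // /unbump ltnNge ltnW // subn0.
Qed.

(** Desnanot-Jacobi for omega_0, ..., omega_{n-1}, 1, omega_n with n = m+1. By [nat_det_ins] the
    full determinant is a multiple of [tau n], and the minor [U] ending with the column of [1] is a
    multiple of [tau m]; replacing the last row by the next one is a twist. *)
Lemma tau_toda (R : realType) (m : nat) : tau R m.+1 != 0 ->
  m.+1%:R ^+ 2 * tau R m.+1 ^+ 2 =
  tau R m * (tau R m.+2)^`() - (tau R m)^`() * tau R m.+2
  + m.+1%:R * tau R m * tau R m.+2.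
Proof.
set n := m.+1 => tau_n0.
pose F := jet (ins_weight R n) (ins_poly R n).
(* Total weight of [U], since the inserted [1] has weight zero. It cancels in the difference of
   products, leaving only the weight n of the last column. *)
pose L : R := \sum_(j < n) j%:R.
have lo i j : (j < n)%N -> F i j = jet (fun j => j%:R) (@Xa R) i j.
  move=> jn; rewrite /F /jet /ins_weight /ins_poly ltn_eqF //.
  by rewrite /unbump ltnNge ltnW // subn0.
have hi i : F i n.+1 = jet (fun j => j%:R) (@Xa R) i n.
  rewrite /F /jet /ins_weight /ins_poly gtn_eqF // /unbump ltnS leqnn.
  by rewrite subn1.
have Fn : nat_det n F = tau R n by apply: eq_nat_det => i j _; apply: lo.
have := @desnanot_jacobi _ n F; rewrite Fn => /(_ tau_n0) /=.
have set_id i : set_at n n i = i by rewrite /set_at; case: eqP.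
have loc i j : (j < n.+1)%N ->
    F i (set_at n n.+1 j) = jet (fun j => j%:R) (@Xa R) i j.
  rewrite ltnS leq_eqVlt /set_at => /orP[/eqP ->|jn]; first by rewrite eqxx hi.
  by rewrite ltn_eqF // lo.
pose U := nat_det n.+1 F.
have -> : nat_det n.+1 (fun i j => F (set_at n n i) (set_at n n j)) = U.
  by apply: eq_nat_det => i j _ _; rewrite !set_id.
have -> : nat_det n.+1 (fun i j => F (set_at n n.+1 i) (set_at n n j))
    = twist L U.
  rewrite /U /L -sum_ins_weight twist_nat_det_jet.
  by apply: eq_nat_det => i j _ _; rewrite set_id.
have -> : nat_det n.+1 (fun i j => F (set_at n n i) (set_at n n.+1 j))
    = tau R n.+1.
  by apply: eq_nat_det => i j _ jn; rewrite set_id loc.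
have -> : nat_det n.+1 (fun i j => F (set_at n n.+1 i) (set_at n n.+1 j))
    = twist (L + n%:R) (tau R n.+1).
  rewrite /L -(big_ord_recr n (fun j : 'I__ => (j : nat)%:R)) twist_nat_det_jet.
  by apply: eq_nat_det => i j _ jn; rewrite loc.
rewrite /U /F !nat_det_ins // factS.
have -> (c : {poly R}) : (-1) ^+ n * (m`!%:R ^+ 2 * c)
    = ((-1) ^+ n * m`!%:R ^+ 2)%:P * c.
  by rewrite polyCM !polyC_exp polyCN polyC_natr polyC1 mulrA.
rewrite /twist !mul_polyC derivZ -!mul_polyC polyCD natrM polyCM !polyC_exp.
rewrite !polyC_natr polyCN polyC1 => E.
have c0 : (-1) ^+ n * m`!%:R ^+ 2 != 0 :> {poly R}.
  rewrite mulf_neq0 // ?signr_eq0 // expf_neq0 // -polyC_natr polyC_eq0.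
  by rewrite pnatr_eq0 -lt0n fact_gt0.
apply: (mulfI c0); transitivity (tau R n *
   ((-1) ^+ n * ((n%:R * m`!%:R) ^+ 2 * tau R n))); first by ring.
by rewrite E; ring.
Qed.

(** * Normalisation *)

(** The convention [0.-1 = 0] extends the constants to index 0, where the later inductions start
    with [calP 0 = 1]. *)
Lemma cn0 (R : realType) : cn R 0 = 1.
Proof. by rewrite /cn big_geq // mulr1 invr1. Qed.

Lemma cnS (R : realType) (n : nat) : cn R n.+1 = cn R n / n`!%:R.
Proof.
rewrite /cn; case: n => [|n]; first by rewrite !big_geq // mulr1 divr1.
rewrite big_nat_recr //= [X in _ * (_ * X)]big_geq // mulr1.
rewrite (eq_big_nat _ _ (F2 := fun i =>
   (\prod_(i.+1 <= j < n.+1) (j - i)%:R) * (n.+1 - i)%:R)); last first.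
  by move=> i /andP[_ ilt]; rewrite big_nat_recr.
rewrite big_split /=.
have -> : \prod_(1 <= i < n.+1) (n.+1 - i)%:R = n`!%:R :> R.
  rewrite big_nat_rev fact_prod natr_prod /=; apply: eq_big_nat => i.
  by move=> /andP[i0 ilt]; congr (_%:R); lia.
by rewrite -invfM; congr (_^-1); ring.
Qed.

Definition calP (R : realType) (n : nat) : {poly R} := cn R n *: tau R n.

(** The identity [cE] between three consecutive constants turns the coefficient (m+1)^2 of
    [tau_toda] into m+1. *)
Lemma calP_toda (R : realType) (m : nat) : tau R m.+1 != 0 ->
  (calP R m.+2)^`() * calP R m - calP R m.+2 * (calP R m)^`()
  + m.+1%:R%:P * calP R m.+2 * calP R m
  = m.+1%:R%:P * (calP R m.+1 * calP R m.+1).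
Proof.
move=> /tau_toda toda; rewrite /calP !derivZ.
have cE : cn R m.+2 * cn R m * m.+1%:R = cn R m.+1 * cn R m.+1.
  have f0 : m`!%:R != 0 :> R by rewrite pnatr_eq0 -lt0n fact_gt0.
  have m0 : 1 + m%:R != 0 :> R by rewrite nat1r pnatr_eq0.
  rewrite !cnS factS natrM; field.
  by rewrite f0 m0.
move: (congr1 polyC cE); rewrite !polyCM !polyC_natr -!mul_polyC => {}cE.
transitivity ((cn R m.+2)%:P * (cn R m)%:P *
    (m.+1%:R ^+ 2 * tau R m.+1 ^+ 2)); first by rewrite toda; ring.
transitivity (((cn R m.+2)%:P * (cn R m)%:P * m.+1%:R) * m.+1%:R
    * tau R m.+1 ^+ 2); first by ring.
by rewrite cE; ring.
Qed.

(** * Degrees and the bilinear equation *)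

(** The term k b a strictly dominates the two terms with a derivative, so deg b + deg a = 2 deg
    c. *)
Lemma size_toda (R : idomainType) (m : nat) (k : R) (a b c : {poly R}) :
  k != 0 -> size a = m.+1 -> size c = m.+2 ->
  b^`() * a - b * a^`() + k%:P * b * a = k%:P * (c * c) -> size b = m.+3.
Proof.
move=> k0 sa sc toda.
have a0 : a != 0 by rewrite -size_poly_gt0 sa.
have c0 : c != 0 by rewrite -size_poly_gt0 sc.
have b0 : b != 0.
  apply: contra_eq_neq toda => ->.
  rewrite deriv0 !(mul0r, mulr0) subr0 addr0 eq_sym.
  by rewrite !mulf_neq0 ?polyC_eq0.
have sba : size (b * a) = (size b + m)%N by rewrite size_mul // sa addnS.
have := congr1 (fun p : {poly R} => size p) toda.
rewrite /= -mulrA addrC !mul_polyC size_polyDl !size_scale // ?sba; last first.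
  have b_gt0 : (0 < size b)%N by rewrite size_poly_gt0.
  rewrite (leq_ltn_trans (size_polyD _ _)) // size_polyN gtn_max.
  apply/andP; split; apply: (leq_ltn_trans (size_polyMleq _ _)).
    rewrite sa addnS /= ltn_add2r; exact: lt_size_deriv.
  have : (size a^`() < m.+1)%N by rewrite -sa lt_size_deriv.
  rewrite ltnS => le; rewrite -ltnS prednK ?addn_gt0 ?b_gt0 //.
  by rewrite ltnS leq_add2l.
by rewrite size_mul // sc; move: (size b) => s; lia.
Qed.

(* Abel's formula in disguise: the bilinear equation for [a], [b] says that
   [a / b] solves a second order linear equation with coefficients built from
   [b], and [c / b] is the second solution selected by the Wronskian relation
   [toda]. *)
Lemma bilinear_step (R : idomainType) (m : nat) (a b c : {poly R}) : a != 0 ->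
  b^`()^`() * a - 2%:P * b^`() * a^`() + b * a^`()^`()
  + m%:R%:P * b^`() * a - m.+1%:R%:P * b * a^`() = 0 ->
  c^`() * a - c * a^`() + m.+1%:R%:P * c * a = m.+1%:R%:P * (b * b) ->
  c^`()^`() * b - 2%:P * c^`() * b^`() + c * b^`()^`()
  + m.+1%:R%:P * c^`() * b - m.+2%:R%:P * c * b^`() = 0.
Proof.
move=> a0 bil toda; apply: (mulfI a0); rewrite mulr0.
have := congr1 (@deriv R) toda; rewrite -!mulrA !mul_polyC.
rewrite derivD derivB !derivZ !derivM => dtoda.
have /eqP := toda; rewrite -subr_eq0 => /eqP {}toda.
have /eqP := dtoda; rewrite -subr_eq0 => /eqP {}dtoda.
(* The zeros stand for the equation [bil], the differentiated relation [dtoda] and [toda]; with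
   multipliers c, b and -2b' they add up to a times the goal. *)
transitivity (c * 0 + b * 0 - 2%:P * b^`() * 0).
  2: by rewrite !mulr0 subr0 addr0.
rewrite -{1}bil -{1}dtoda -toda -!mul_polyC !polyC_natr; ring.
Qed.

Lemma calP0 (R : realType) : calP R 0 = 1.
Proof. by rewrite /calP cn0 scale1r /tau /nat_det det_mx00. Qed.

Lemma calP1 (R : realType) : calP R 1 = 'X.
Proof.
rewrite /calP cnS cn0 divr1 scale1r /tau /nat_det det_mx11 mxE.
by rewrite /jet /Xa /= subr0.
Qed.

Lemma calP2 (R : realType) : calP R 2 = 'X ^+ 2 - 2%:P * 'X + 2%:P.
Proof.
rewrite /calP !cnS cn0 !divr1 scale1r /tau /nat_det det_mx2 !mxE.
rewrite /jet /twist /Xa /= add0r divr1 !derivXsubC !subr0.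
rewrite !scale0r !scale1r addr0; ring.
Qed.

Lemma size_calP (R : realType) (n : nat) : size (calP R n) = n.+1.
Proof.
(* Two consecutive sizes are carried along; the second also shows that [tau R n.+1] is nonzero, as
   [calP_toda] requires. *)
suff : size (calP R n) = n.+1 /\ size (calP R n.+1) = n.+2 by case.
elim: n => [|n [sn sn1]]; first by rewrite calP0 calP1 size_poly1 size_polyX.
split=> //; apply: (size_toda (k := n.+1%:R) _ sn sn1).
  by rewrite pnatr_eq0.
apply: calP_toda; apply: contra_eq_neq sn1 => t0.
by rewrite /calP t0 scaler0 size_poly0.
Qed.

Lemma calP_bilinear (R : realType) (n : nat) :
  (calP R n.+1)^`()^`() * calP R n
  - 2%:P * (calP R n.+1)^`() * (calP R n)^`()
  + calP R n.+1 * (calP R n)^`()^`()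
  + n%:R%:P * (calP R n.+1)^`() * calP R n
  - n.+1%:R%:P * calP R n.+1 * (calP R n)^`() = 0.
Proof.
have calP_neq0 m : calP R m != 0 by rewrite -size_poly_gt0 size_calP.
elim: n => [|n IHn].
  by rewrite calP0 calP1 derivX -polyC1 !derivC; ring.
apply: (bilinear_step (calP_neq0 n) IHn); apply: calP_toda.
by apply: contra_neq (calP_neq0 n.+1) => t0; rewrite /calP t0 scaler0.
Qed.

(** * From polynomials back to the analytic Wronskian *)

Lemma derive1_poly_expR (R : realType) (p : {poly R}) (c : R) :
  ((fun x => p.[x] * expR (c * x) : R)^`())%classic =
  (fun x => (twist c p).[x] * expR (c * x)).
Proof.
apply/funext => x; rewrite derive1E.
have dc : is_derive x (1 : R) (fun y => c * y) c.
  by apply: is_derive_eq; rewrite /GRing.scale /= mulr1.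
have dexp := is_derive1_comp (is_derive_expR (c * x)) dc.
have := is_deriveM (is_derive_poly p x) dexp.
move=> /@derive_val /= ->.
by rewrite /twist hornerD hornerZ /GRing.scale /=; ring.
Qed.

Lemma derive1n_omega (R : realType) (i j : nat) :
  derive1n i (@omega R j) =
  (fun x => (jet (fun k => k%:R) (@Xa R) i j).[x] * expR (j%:R * x)).
Proof.
elim: i => [|i IHi]; last by rewrite derive1nS IHi derive1_poly_expR.
by apply/funext => x; rewrite derive1n0 /jet /omega /Xa /= hornerXsubC.
Qed.

(** Column j releases the factor exp(j x), and the weights 0, ..., n-1 add up to n(n-1)/2. *)
Lemma wronskian_omega (R : realType) (n : nat) (x : R) :
  wronskian (fun j : 'I_n => @omega R j) x =
  (tau R n).[x] * expR ((n * n.-1)%:R * x / 2).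
Proof.
transitivity (nat_det n (fun i j =>
    (jet (fun k => k%:R) (@Xa R) i j).[x] * expR (j%:R * x))).
  by congr (\det _); apply/matrixP => i j; rewrite !mxE derive1n_omega.
rewrite (nat_det_scale_col _ (fun j => expR (j%:R * x))); congr (_ * _).
  rewrite -[RHS]/(horner_eval x _) /tau /nat_det -det_map_mx.
  by congr (\det _); apply/matrixP => i j; rewrite !mxE.
rewrite -expR_sum -mulr_suml -natr_sum; congr expR.
rewrite -(big_mkord xpredT id) mulrAC; congr (_ * _).
have two0 : 2 != 0 :> R by rewrite pnatr_eq0.
apply: (mulIf two0); rewrite mulfVK // -natrM bin2_sum.
(* Halving in [nat] is exact here because n(n-1) is even. *)
rewrite muln2 bin2 halfK; congr (_%:R); case: n => // n.
by rewrite /= oddM /= andNb subn0.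
Qed.

Theorem theorem6p1 (R : realType) :
  exists P : nat -> {poly R},
    [/\ (forall n, (1 <= n)%N -> size (P n) = n.+1),
        P 1%N = 'X,
        P 2%N = 'X ^+ 2 - 2%:P * 'X + 2%:P,
        (forall n, (1 <= n)%N ->
           (P n.+1)^`() ^`() * P n - 2%:P * (P n.+1)^`() * (P n)^`()
           + P n.+1 * (P n)^`() ^`() + n%:R%:P * (P n.+1)^`() * P n
           - (n.+1)%:R%:P * P n.+1 * (P n)^`() = 0)
      & (forall n, (1 <= n)%N -> forall x : R,
           (P n).[x] = cn R n * expR (- ((n * n.-1)%:R * x / 2))
                       * wronskian (fun j : 'I_n => @omega R j) x)].
Proof.
exists (calP R); split.
- by move=> n _; exact: size_calP.
- exact: calP1.
- exact: calP2.
- by move=> n _; exact: calP_bilinear.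
- move=> n _ x; rewrite wronskian_omega /calP hornerZ mulrACA expRN.
  by rewrite mulVf ?mulr1 // gt_eqF // expR_gt0.
Qed.
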